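(* Let $G<\mathrm{Aut}(\mathsf X^* )$, $\mathsf X=\{1,\dots,8\}$, be the Sierpiński carpet group. Then $G$ is branch and just-infinite. More explicitly, $\mathrm{RiSt}(1)=G^{\mathsf X}$, so that the wreath recursion $G\to\mathrm{Alt}(\mathsf X)\ltimes G^{\mathsf X}$ is an isomorphism, and $G/G'\cong(\mathbb Z/2\mathbb Z)^4$.
   Context: The Sierpiński carpet group $G$ is the group of automorphisms of the rooted tree $\mathsf X^*$ of finite words over $\mathsf X=\{1,2,\dots,8\}$ generated by $a,b,c,d$ defined recursively by $a=(12)(67)(1,1,a,1,a,1,1,a)$, $b=(46)(58)(b,b,b,1,1,1,1,1)$, $c=(23)(78)(c,1,1,c,1,c,1,1)$, $d=(14)(35)(1,1,1,1,1,d,d,d)$, where $g=\pi(g_1,\dots,g_8)$ with $\pi\in\mathrm{Sym}(\mathsf X)$ means $g(xw)=\pi(x)\,g_x(w)$ for $x\in\mathsf X$, $w\in\mathsf X^*$. The assignment $g\mapsto\pi(g_1,\dots,g_8)$ is the wreath recursion. A tuple $(g_x)_{x\in\mathsf X}$ is identified with the automorphism $xw\mapsto xg_x(w)$; in this way $G^{\mathsf X}$ is a subgroup of $\mathrm{Aut}(\mathsf X^* )$. $\mathrm{Alt}(\mathsf X)$ acts on $\mathsf X^*$ by $xw\mapsto\pi(x)w$. For a vertex $v$, $\mathrm{RiSt}(v)$ is the subgroup of elements of $G$ fixing every vertex outside the subtree $v\mathsf X^*$, and $\mathrm{RiSt}(n)=\langle\mathrm{RiSt}(v):|v|=n\rangle$.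 $G$ is branch if it is transitive on every level $\mathsf X^n$ and $\mathrm{RiSt}(n)$ has finite index in $G$ for every $n$. $G$ is just-infinite if every quotient by a nontrivial normal subgroup is finite. $G'$ is the commutator subgroup. *)

(* Defs.v *)
From HB Require Import structures.
From mathcomp Require Import all_boot all_order all_algebra all_fingroup.
From mathcomp Require Import all_solvable.
From mathcomp Require Import mathcomp_extra boolp classical_sets functions.
From mathcomp Require Import cardinality.

Set Implicit Arguments.
Unset Strict Implicit.
Unset Printing Implicit Defensive.

Local Open Scope classical_set_scope.
Local Open Scope group_scope.

(* MathComp's subgroup and quotient theory only covers finite groups, so the
   notions needed for an arbitrary groupType are spelled out here. *)
Section Groups.
Variable gT : groupType.
Implicit Types G H N S A B : set gT.

Definition is_subgroup H : Prop :=
  [/\ H 1, forall x y, H x -> H y -> H (x * y) & forall x, H x -> H x^-1].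

Definition generated S : set gT := smallest is_subgroup S.

Definition is_normal N G : Prop :=
  [/\ is_subgroup N, N `<=` G & forall x g, N x -> G g -> N (x ^ g)].

Definition set_mul A B : set gT := [set x * y | x in A & y in B].

(* The underlying set of the quotient G / N, whose group law (when N is normal
   in G) is set_mul. *)
Definition cosets G N : set (set gT) := [set set_mul [set g] N | g in G].

Definition finite_index N G : Prop := finite_set (cosets G N).

Definition derived_subgroup G : set gT :=
  generated [set [~ x, y] | x in G & y in G].

Definition just_infinite G : Prop :=
  forall N, is_normal N G -> N <> [set 1] -> finite_index N G.

End Groups.

(* f restricts to an isomorphism from (A, opT) onto (B, opU). *)
Definition isomorphism T U (opT : T -> T -> T) (opU : U -> U -> U)
    (A : set T) (B : set U) (f : T -> U) : Prop :=
  set_bij A B f /\ forall x y, A x -> A y -> f (opT x y) = opU (f x) (f y).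

Definition isomorphic T U (opT : T -> T -> T) (opU : U -> U -> U)
    (A : set T) (B : set U) : Prop :=
  exists f, isomorphism opT opU A B f.

Section TreeAut.
Variable X : finType.
Implicit Types (u v w : seq X) (x : X).

(* The edges of the rooted tree X^*, oriented away from the root [::]. *)
Definition child u v : Prop := exists x, v = rcons u x.

Definition is_tree_aut (f : seq X -> seq X) : Prop :=
  [/\ bijective f, f [::] = [::] & forall u v, child (f u) (f v) <-> child u v].

Record tree_aut := TreeAut {
  tree_aut_fun :> seq X -> seq X;
  tree_autP : is_tree_aut tree_aut_fun }.

HB.instance Definition _ := gen_eqMixin tree_aut.
HB.instance Definition _ := gen_choiceMixin tree_aut.

Implicit Types f g : tree_aut.

Lemma tree_aut_eq f g : f =1 g -> f = g.
Proof.
case: f g => [f fP] [g gP] /= /funext fg.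
by case: _ / fg gP => gP; congr TreeAut; exact: Prop_irrelevance.
Qed.

Lemma tree_aut1_subproof : is_tree_aut id.
Proof. by split=> //; exists id. Qed.

Definition tree_aut1 := TreeAut tree_aut1_subproof.

Lemma tree_autM_subproof f g : is_tree_aut (f \o g).
Proof.
have [fb f0 fc] := tree_autP f; have [gb g0 gc] := tree_autP g.
by split=> [||u v]; [exact: bij_comp|rewrite /= g0|rewrite /= fc gc].
Qed.

(* Automorphisms act on the left: f * g is "first g, then f". *)
Definition tree_autM f g := TreeAut (tree_autM_subproof f g).

Lemma tree_autV_exists f :
  exists g : seq X -> seq X, [/\ cancel f g, cancel g f & is_tree_aut g].
Proof.
have [[g fK gK] f0 fc] := tree_autP f; exists g; split=> //.
split=> [||u v]; first by exists f.
  by rewrite -{1}f0 fK.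
by rewrite -fc !gK.
Qed.

Definition tree_autV f : tree_aut :=
  let: exist _ (And3 _ _ gP) := cid (tree_autV_exists f) in TreeAut gP.

Lemma tree_autVK f : cancel f (tree_autV f) /\ cancel (tree_autV f) f.
Proof. by rewrite /tree_autV; case: cid => g []. Qed.

Lemma tree_autA : associative tree_autM.
Proof. by move=> f g h; exact: tree_aut_eq. Qed.
Lemma tree_aut1M : left_id tree_aut1 tree_autM.
Proof. by move=> f; exact: tree_aut_eq. Qed.
Lemma tree_autM1 : right_id tree_aut1 tree_autM.
Proof. by move=> f; exact: tree_aut_eq. Qed.
Lemma tree_autVM : left_inverse tree_aut1 tree_autV tree_autM.
Proof. by move=> f; apply: tree_aut_eq => w /=; rewrite (tree_autVK f).1. Qed.
Lemma tree_autMV : right_inverse tree_aut1 tree_autV tree_autM.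
Proof. by move=> f; apply: tree_aut_eq => w /=; rewrite (tree_autVK f).2. Qed.

HB.instance Definition _ := isGroup.Build tree_aut
  tree_autA tree_aut1M tree_autM1 tree_autVM tree_autMV.

Lemma tree_autME f g w : (f * g) w = f (g w). Proof. by []. Qed.
Lemma tree_aut1E w : (1 : tree_aut) w = w. Proof. by []. Qed.

Lemma tree_aut_nil f : f [::] = [::].
Proof. by case: (tree_autP f). Qed.

Lemma tree_aut_rcons f w x : exists y, f (rcons w x) = rcons (f w) y.
Proof. by have [_ _ fc] := tree_autP f; apply/fc; exists x. Qed.

Lemma size_tree_aut f w : size (f w) = size w.
Proof.
elim/last_ind: w => [|w x IH]; first by rewrite tree_aut_nil.
by have [y ->] := tree_aut_rcons f w x; rewrite !size_rcons IH.
Qed.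

Lemma tree_aut_cat f u v : exists2 t, f (u ++ v) = f u ++ t & size t = size v.
Proof.
elim/last_ind: v => [|v x [t ft st]]; first by exists [::]; rewrite ?cats0.
have [y fy] := tree_aut_rcons f (u ++ v) x.
by exists (rcons t y); rewrite ?size_rcons ?st // -rcons_cat fy ft rcons_cat.
Qed.

(* The wreath recursion g = pi (g_x)_x, with g (x :: w) = pi x :: g_x w. *)
Definition root_fun f x : X := head x (f [:: x]).
Definition section_fun f x w : seq X := behead (f (x :: w)).

Lemma tree_aut_cons f x w : f (x :: w) = root_fun f x :: section_fun f x w.
Proof.
rewrite /root_fun /section_fun; have [t ft _] := tree_aut_cat f [:: x] w.
rewrite -cat1s ft; have := size_tree_aut f [:: x].
by case: (f [:: x]) => // y [].
Qed.

Lemma root_fun_inj f : injective (root_fun f).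
Proof.
move=> x y fxy; have [fb _ _] := tree_autP f.
suff: f [:: x] = f [:: y] by move/(bij_inj fb) => -[].
have sx := size_tree_aut f [:: x]; have sy := size_tree_aut f [:: y].
rewrite !tree_aut_cons fxy; congr (_ :: _).
move: sx sy; rewrite !tree_aut_cons /=.
by case: section_fun => // _; case: section_fun.
Qed.

Definition root_perm f : {perm X} := perm (@root_fun_inj f).

Lemma child_cons x u v : child (x :: u) (x :: v) <-> child u v.
Proof.
by split=> -[y]; [rewrite rcons_cons => -[->]|move=> ->]; exists y.
Qed.

Lemma section_subproof f x : is_tree_aut (section_fun f x).
Proof.
have [[g fK gK] f0 fc] := tree_autP f; split=> [||u v].
- exists (fun w => behead (g (root_fun f x :: w))) => w.
    by rewrite -tree_aut_cons fK.
  have := gK (root_fun f x :: w); case def_g: (g _) => [|y t].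
    by rewrite f0.
  rewrite tree_aut_cons => -[/root_fun_inj exy <-] /=; by rewrite exy.
- by apply: size0nil; rewrite size_behead size_tree_aut.
- by rewrite -(child_cons (root_fun f x)) -!tree_aut_cons fc child_cons.
Qed.

Definition section f x : tree_aut := TreeAut (section_subproof f x).

(* Sym(X) |>< Aut(X^* )^X. *)
Record wreath := Wreath {
  wr_perm : {perm X};
  wr_sect : {ffun X -> tree_aut} }.

HB.instance Definition _ := gen_eqMixin wreath.
HB.instance Definition _ := gen_choiceMixin wreath.

Implicit Types p q r : wreath.

Definition wreath1 := Wreath 1 [ffun=> 1].

(* (pi (g_x)) * (rho (h_x)) = (pi \o rho) (g_(rho x) * h_x).
   Beware that permutations multiply on the right in MathComp: the product
   rho * pi below is the composition "first rho, then pi". *)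
Definition wreathM p q :=
  Wreath (wr_perm q * wr_perm p)
         [ffun x => wr_sect p (wr_perm q x) * wr_sect q x].

Definition wreathV p :=
  Wreath (wr_perm p)^-1 [ffun x => (wr_sect p ((wr_perm p)^-1 x))^-1].

Lemma wreath_eq p q :
  wr_perm p = wr_perm q -> wr_sect p =1 wr_sect q -> p = q.
Proof. by case: p q => [p f] [q g] /= -> /ffunP->. Qed.

Lemma wreathA : associative wreathM.
Proof.
move=> p q r; apply: wreath_eq => [|x]; first by rewrite /= mulgA.
by rewrite !ffunE /= permM mulgA.
Qed.
Lemma wreath1M : left_id wreath1 wreathM.
Proof.
move=> p; apply: wreath_eq => [|x]; first by rewrite /= mulg1.
by rewrite !ffunE mul1g.
Qed.
Lemma wreathM1 : right_id wreath1 wreathM.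
Proof.
move=> p; apply: wreath_eq => [|x]; first by rewrite /= mul1g.
by rewrite !ffunE perm1 mulg1.
Qed.
Lemma wreathVM : left_inverse wreath1 wreathV wreathM.
Proof.
move=> p; apply: wreath_eq => [|x]; first by rewrite /= mulgV.
by rewrite !ffunE permK mulVg.
Qed.
Lemma wreathMV : right_inverse wreath1 wreathV wreathM.
Proof.
move=> p; apply: wreath_eq => [|x]; first by rewrite /= mulVg.
by rewrite !ffunE mulgV.
Qed.

HB.instance Definition _ := isGroup.Build wreath
  wreathA wreath1M wreathM1 wreathVM wreathMV.

Definition wreath_recursion f : wreath :=
  Wreath (root_perm f) [ffun x => section f x].

Lemma wreath_recursionM : {morph wreath_recursion : f g / f * g}.
Proof.
move=> f g; have fgE x w := tree_autME f g (x :: w).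
apply: wreath_eq => [|x].
  apply/permP=> x; rewrite permM !permE.
  by have := fgE x [::]; rewrite !tree_aut_cons => -[].
rewrite !ffunE; apply: tree_aut_eq => w /=; rewrite permE.
by have := fgE x w; rewrite !tree_aut_cons => -[].
Qed.

(* The automorphism x :: w |-> x :: h x w attached to a tuple h. *)
Definition tuple_fun (h : {ffun X -> tree_aut}) w : seq X :=
  if w is x :: w' then x :: h x w' else [::].

Lemma tuple_subproof h : is_tree_aut (tuple_fun h).
Proof.
split=> // [|[|x u] [|y v]] /=.
- exists (tuple_fun [ffun x => (h x)^-1]); move=> [|x w] //=; rewrite ffunE.
    by rewrite (tree_autVK _).1.
  by rewrite (tree_autVK _).2.
- by split=> -[z].
- by split=> -[z [-> e]]; exists z; rewrite ?e ?tree_aut_nil //;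
    congr [:: _ & _]; apply/size0nil; rewrite -(size_tree_aut (h z)) e.
- by split=> -[z]; rewrite rcons_cons.
- have [exy|nxy] := eqVneq x y; last first.
    by split=> -[z [/esym/eqP]]; rewrite (negPf nxy).
  by rewrite -exy !child_cons; have [_ _ ->] := tree_autP (h x).
Qed.

Definition tuple_aut h : tree_aut := TreeAut (tuple_subproof h).

Implicit Type G : set tree_aut.

(* G^X as a subgroup of Aut(X^* ). *)
Definition power_subgroup G : set tree_aut :=
  [set tuple_aut h | h in [set h : {ffun X -> tree_aut} | forall x, G (h x)]].

Definition alt_wreath G : set wreath :=
  [set p | wr_perm p \in 'Alt_X /\ forall x, G (wr_sect p x)].

Definition rist_vertex G v : set tree_aut :=
  [set g | G g /\ forall w, ~~ prefix v w -> g w = w].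

Definition rist_level G (n : nat) : set tree_aut :=
  generated (\bigcup_(v in [set v | size v = n]) rist_vertex G v).

Definition level_transitive G : Prop :=
  forall (n : nat) u v, size u = n -> size v = n -> exists2 g, G g & g u = v.

Definition branch G : Prop :=
  level_transitive G /\ forall n, finite_index (rist_level G n) G.

End TreeAut.

(* The letters 1, ..., 8 are the ordinals 0, ..., 7. *)
Definition letter (k : nat) : 'I_8 := inord k.-1.

(* The states of the automaton generating the Sierpinski carpet group, the
   wreath recursion of each state, and the transformation it defines. *)
Inductive state := st1 | sta | stb | stc | std.

Definition state_perm (s : state) : {perm 'I_8} :=
  match s with
  | st1 => 1
  | sta => tperm (letter 1) (letter 2) * tperm (letter 6) (letter 7)
  | stb => tperm (letter 4) (letter 6) * tperm (letter 5) (letter 8)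
  | stc => tperm (letter 2) (letter 3) * tperm (letter 7) (letter 8)
  | std => tperm (letter 1) (letter 4) * tperm (letter 3) (letter 5)
  end.

Definition state_sections (s : state) : seq state :=
  match s with
  | st1 => [:: st1; st1; st1; st1; st1; st1; st1; st1]
  | sta => [:: st1; st1; sta; st1; sta; st1; st1; sta]
  | stb => [:: stb; stb; stb; st1; st1; st1; st1; st1]
  | stc => [:: stc; st1; st1; stc; st1; stc; st1; st1]
  | std => [:: st1; st1; st1; st1; st1; std; std; std]
  end.

Definition state_section (s : state) (x : 'I_8) : state :=
  nth st1 (state_sections s) x.

Fixpoint run (s : state) (w : seq 'I_8) : seq 'I_8 :=
  if w is x :: w' then state_perm s x :: run (state_section s x) w' else [::].

Fixpoint run_inv (s : state) (w : seq 'I_8) : seq 'I_8 :=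
  if w is x :: w' then
    let y := (state_perm s)^-1 x in y :: run_inv (state_section s y) w'
  else [::].

Lemma run_subproof s : is_tree_aut (run s).
Proof.
split=> // [|u v].
  exists (run_inv s) => w; elim: w s => //= x w IH s.
    by rewrite permK IH.
  by rewrite permKV IH.
elim: u v s => [|x u IH] [|y v] s /=.
- by split=> -[].
- split=> -[z [_ /(congr1 size)/= sv]].
    have -> : v = [::] by case: v sv.
    by exists y.
  have -> : v = [::] by case: v sv.
  by exists (state_perm s y).
- by split=> -[].
- have [exy|nxy] := eqVneq x y; last first.
    split=> -[z [/esym e]]; last by rewrite e eqxx in nxy.
    by rewrite (perm_inj e) eqxx in nxy.
  by rewrite -exy !child_cons IH.
Qed.

Definition state_aut (s : state) : tree_aut 'I_8 :=
  TreeAut (run_subproof s).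

Lemma state_aut1 : state_aut st1 = 1.
Proof.
apply: tree_aut_eq; elim=> //= x w IH; rewrite perm1 /state_section.
by rewrite (_ : nth _ _ _ = st1) ?IH //; case: x => -[|[|[|[|[|[|[|[]]]]]]]].
Qed.

Lemma wreath_recursion_state s :
  wreath_recursion (state_aut s)
  = Wreath (state_perm s) [ffun x => state_aut (state_section s x)].
Proof.
apply: wreath_eq => [|x]; first by apply/permP => x; rewrite permE.
by rewrite !ffunE; exact: tree_aut_eq.
Qed.

Definition carpet_group : set (tree_aut 'I_8) :=
  generated [set state_aut sta; state_aut stb; state_aut stc; state_aut std].

(* Main.v *)
(** The elements t = (st)^2, for s and t adjacent in the cyclic order a, b, c, d,
    act on the first letter as a 3-cycle and have a single nontrivial section,
    equal to t itself, at a corner letter fixed by the 3-cycle.  Commutators of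
    two such elements at adjacent corners therefore only change the first letter,
    and they generate Alt(X).  Multiplying s by the element of Alt(X) with the
    same action on X leaves the tuple with entry s at three letters, and three
    Alt(X)-conjugates of it multiply to a tuple with a single nontrivial entry s;
    hence G contains G^X and equals Alt(X) |>< G^X.

    For the abelianization, a word representing 1 contains each generator s an
    even number of times: s has three nontrivial sections, all equal to s, so the
    parity of s in a word is the sum of its parities in the eight sections.  One
    descends to shorter words, unless a section is as long as the word, in which
    case the word only involves the generators attached to one corner and the
    claim is visible on X.

    Finally, a normal subgroup containing an element moving v contains
    the copy of G' acting below v, and hence, by transitivity, the product of such
    copies over the level of v, which has finite index because G/G' is finite. *)

From HB Require Import structures.
From mathcomp Require Import all_boot all_order all_algebra all_fingroup.
From mathcomp Require Import primitive_action alt.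
From mathcomp Require Import boolp classical_sets functions cardinality.
Require Import Defs.

Set Implicit Arguments.
Unset Strict Implicit.
Unset Printing Implicit Defensive.

Local Open Scope classical_set_scope.

(** * Generated subgroups, finite index, and homomorphisms to abelian groups *)

Section Groups.
Local Open Scope group_scope.
Variable gT : groupType.
Implicit Types G H N S : set gT.

Lemma generated_subgroup S : is_subgroup (generated S).
Proof.
split=> [H [[]] //|x y Sx Sy H HS|x Sx H HS]; have [[_ HM HV] _] := HS.
  by apply: HM; [exact: Sx|exact: Sy].
by apply: HV; exact: Sx.
Qed.

Lemma sub_generated S : S `<=` generated S.
Proof. by move=> x Sx H [_]; exact. Qed.

Lemma generated_min H S : is_subgroup H -> S `<=` H -> generated S `<=` H.
Proof. by move=> gH sSH x; exact. Qed.

Lemma preimage_subgroup (rT : groupType) (f : gT -> rT) (K : set rT) :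
  {morph f : x y / x * y} -> is_subgroup K -> is_subgroup (f @^-1` K).
Proof.
move=> fM [K1 KM KV]; have f1 : f 1 = 1.
  by apply: (mulgI (f 1)); rewrite -fM !mulg1.
split=> [|x y Kx Ky|x Kx] /=; first by rewrite f1.
  by rewrite fM; exact: KM.
suff -> : f x^-1 = (f x)^-1 by exact: KV.
by apply: (mulgI (f x)); rewrite -fM !mulgV.
Qed.

Lemma set_mul1P g N x : set_mul [set g] N x <-> N (g^-1 * x).
Proof.
split=> [[_ -> [y Ny <-]]|Nx]; first by rewrite mulKg.
by exists g => //; exists (g^-1 * x); rewrite ?mulKVg.
Qed.

Lemma coset_eq N g h :
  is_subgroup N -> N (g^-1 * h) -> set_mul [set g] N = set_mul [set h] N.
Proof.
move=> [_ NM NV] Ngh; apply/seteqP; split=> x /set_mul1P Nx; apply/set_mul1P.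
  by rewrite -[x](mulKVg g) mulgA; apply: NM => //; rewrite -[g in _ * g]invgK
    -invMg; exact: NV.
by rewrite -[x](mulKVg h) mulgA; exact: NM.
Qed.

(** Each fibre of [f] in [G] lies in one coset, so there are at most as many cosets as values. [f]
    may be any map; below it records a level action together with invariants of sections. *)
Lemma finite_index_fun (T : finType) (f : gT -> T) G N :
  is_subgroup N -> (forall g h, G g -> G h -> f g = f h -> N (g^-1 * h)) ->
  finite_index N G.
Proof.
move=> gN fN.
(* A representative of the fibre over [t]; the default 1 is only reached for empty fibres. *)
pose c t := set_mul [set xget 1 [set g | G g /\ f g = t]] N.
apply: (@sub_finite_set _ _ (c @` [set: T])); last first.
  by apply: finite_image; exact: finite_finset.
move=> _ [g Gg <-]; exists (f g) => //; apply: coset_eq => //.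
have [|Gx fx] := @xgetPex _ 1 [set h | G h /\ f h = f g]; first by exists g.
by apply: fN; rewrite ?fx.
Qed.

Section HomZmodule.
Variables (V : zmodType) (chi : gT -> V) (G : set gT).
Hypothesis gG : is_subgroup G.
Hypothesis chiM : forall g h, G g -> G h -> chi (g * h) = (chi g + chi h)%R.

Lemma derived_sub : derived_subgroup G `<=` G.
Proof.
have [G1 GM GV] := gG; apply: generated_min => // _ [g Gg [h Gh <-]].
have Ghg := GM _ _ Gh Gg; rewrite commgEl conjgE.
by apply: (GM _ _ (GV _ Gg)); apply: (GM _ _ (GV _ Gh)); exact: GM.
Qed.

Lemma zmod_hom1 : chi 1 = 0%R.
Proof.
have [G1 _ _] := gG.
by apply: (@GRing.addrI _ (chi 1)); rewrite -chiM // mulg1 GRing.addr0.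
Qed.

Lemma zmod_homV g : G g -> chi g^-1 = (- chi g)%R.
Proof.
have [_ _ GV] := gG; move=> Gg; apply/eqP.
by rewrite -GRing.addr_eq0 -chiM ?mulVg ?zmod_hom1 //; exact: GV.
Qed.

Lemma zmod_hom_derived g : derived_subgroup G g -> chi g = 0%R.
Proof.
have [G1 GM GV] := gG => Dg.
(* [chi] is additive on [G] only, so the kernel is taken inside [G]. *)
suff [] : [set h | G h /\ chi h = 0%R] g by [].
apply: generated_min Dg => [|_ [x Gx [y Gy <-]]].
  split=> [|x y [Gx x0] [Gy y0]|x [Gx x0]] /=; first by split; rewrite ?zmod_hom1.
    by split; [exact: GM|rewrite chiM // x0 y0 GRing.addr0].
  by split; [exact: GV|rewrite zmod_homV // x0 GRing.oppr0].
have Gyx := GM _ _ Gy Gx; have Gxy := GM _ _ Gx Gy; have Gyx' := GV _ Gyx.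
split; first by apply: derived_sub; apply: sub_generated; exists x => //; exists y.
have -> : [~ x, y] = (y * x)^-1 * (x * y) by rewrite commgEl conjgE invMg !mulgA.
rewrite chiM // zmod_homV // !chiM //.
by rewrite GRing.addrC [X in (_ - X)%R]GRing.addrC GRing.subrr.
Qed.

(** First isomorphism theorem: [chi] is evaluated at a chosen element of a coset, and the choice is
    harmless because [chi] vanishes on [N]. *)
Lemma cosets_isomorphic N : is_subgroup N ->
  (forall g, G g -> chi g = 0%R <-> N g) -> N `<=` G ->
  (forall v, exists2 g, G g & chi g = v) ->
  isomorphic (@set_mul gT) (fun u v => (u + v)%R) (cosets G N) [set: V].
Proof.
have [G1 GM GV] := gG; move=> gN chiN NG chi_onto; have [N1 NM NV] := gN.
pose f (C : set gT) := chi (xget 1 C); have chiV := zmod_homV.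
have fE g : G g -> f (set_mul [set g] N) = chi g.
  move=> Gg; have [|y -> [h Nh gh]] := @xgetPex _ 1 (set_mul [set g] N).
    by exists g; apply/set_mul1P; rewrite mulVg.
  by rewrite /f -gh chiM ?(chiN h (NG _ Nh)).2 ?GRing.addr0 //; exact: NG.
have cosetM g h : G g -> G h ->
    set_mul (set_mul [set g] N) (set_mul [set h] N) = set_mul [set g * h] N.
  move=> Gg Gh; apply/seteqP; split=> x.
    move=> [_ [_ -> [n Nn <-]] [_ [_ -> [m Nm <-]] <-]]; apply/set_mul1P.
    have Gn := NG _ Nn; have Gm := NG _ Nm.
    have Ggh := GM _ _ Gg Gh; have Ggn := GM _ _ Gg Gn; have Ghm := GM _ _ Gh Gm.
    apply/chiN; first exact: (GM _ _ (GV _ Ggh) (GM _ _ Ggn Ghm)).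
    rewrite (chiM (GV _ Ggh) (GM _ _ Ggn Ghm)) chiV // !chiM //.
    by rewrite (chiN _ Gn).2 // (chiN _ Gm).2 // !GRing.addr0 GRing.addNr.
  move=> /set_mul1P Nx; exists (g * 1); first by exists g => //; exists 1.
  by exists (h * ((g * h)^-1 * x)); [exists h => //; eexists; first exact: Nx|
    rewrite mulg1 invMg -!mulgA !mulKVg].
exists f; split; first split=> //.
- move=> _ _ /set_mem[g Gg <-] /set_mem[h Gh <-]; rewrite !fE // => gh.
  apply: coset_eq => //; apply/chiN; first by apply: GM => //; exact: GV.
  by rewrite chiM ?chiV ?gh ?GRing.addNr //; exact: GV.
- move=> v _; have [g Gg <-] := chi_onto v.
  by exists (set_mul [set g] N); [exists g|exact: fE].
- by move=> _ _ [g Gg <-] [h Gh <-]; rewrite cosetM ?fE ?chiM //; exact: GM.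
Qed.

End HomZmodule.

End Groups.

(** * Tuples, sections, and branching criteria for self-similar groups *)

Section TreeAutomorphisms.
Local Open Scope group_scope.
Variable X : finType.
Implicit Types (f g h t : tree_aut X) (u v w : seq X) (x y : X).
Implicit Types (G K N : set (tree_aut X)) (F : {ffun X -> tree_aut X}).

Lemma wreath_recursion_inj : injective (@wreath_recursion X).
Proof.
move=> f g [/permP fg1 /ffunP fg2]; apply: tree_aut_eq => -[|x w].
  by rewrite !tree_aut_nil.
have := fg1 x; have := fg2 x; rewrite !tree_aut_cons !permE !ffunE => E ->.
by congr (_ :: _); rewrite -[LHS]/(section f x w) E.
Qed.

Lemma wreath_recursion_tuple F : wreath_recursion (tuple_aut F) = Wreath 1 F.
Proof.
apply: wreath_eq => [|x]; first by apply/permP => x; rewrite permE perm1.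
by rewrite ffunE; apply: tree_aut_eq.
Qed.

Lemma tuple_autM F F' :
  tuple_aut F * tuple_aut F' = tuple_aut [ffun x => F x * F' x].
Proof. by apply: tree_aut_eq => -[|x w] //=; rewrite ffunE. Qed.

Definition delta x g : tree_aut X := tuple_aut [ffun y => if y == x then g else 1].

Lemma deltaM x : {morph delta x : g h / g * h}.
Proof.
move=> g h; rewrite tuple_autM; congr tuple_aut; apply/ffunP=> y; rewrite !ffunE.
by case: eqP => // _; rewrite mulg1.
Qed.

Lemma tuple_aut_sub K F :
  is_subgroup K -> (forall x, K (delta x (F x))) -> K (tuple_aut F).
Proof.
move=> [K1 KM _] KF.
(* Truncate the tuple to the letters in [r] and add one factor [delta x (F x)] at a time. *)
suff KFr r : uniq r -> K (tuple_aut [ffun x => if x \in r then F x else 1]).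
  have := KFr _ (enum_uniq X); congr (K (tuple_aut _)).
  by apply/ffunP => x; rewrite ffunE mem_enum.
elim: r => [_|x r IH /= /andP[xr ur]].
  suff <- : 1 = tuple_aut [ffun x => if x \in [::] then F x else 1] by [].
  by apply: tree_aut_eq => -[|x w] //=; rewrite ffunE.
have := KM _ _ (KF x) (IH ur); rewrite tuple_autM; congr (K (tuple_aut _)).
apply/ffunP => y; rewrite !ffunE inE; have [-> |_] := eqVneq y x.
  by rewrite (negPf xr) mulg1.
by rewrite mul1g.
Qed.

Definition deltas v g : tree_aut X := foldr delta g v.

Definition sections g v : tree_aut X := foldl (@section X) g v.

Lemma deltasM v : {morph deltas v : g h / g * h}.
Proof.
elim: v => // x v IH g h.
by rewrite -[LHS]/(delta x (deltas v _)) IH deltaM.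
Qed.

Lemma deltas_id v g w : ~~ prefix v w -> deltas v g w = w.
Proof.
elim: v w => [w|x v IH [|y w]] //=; first by rewrite prefix0s.
rewrite ffunE eq_sym.
by case: eqP => //= _ /IH; rewrite /deltas => ->.
Qed.

Lemma sections_cat g v w : g (v ++ w) = g v ++ sections g v w.
Proof.
elim: v g => [g|x v IH g]; first by rewrite tree_aut_nil.
by rewrite cat_cons !tree_aut_cons /= -[section_fun g x]/(section g x : _ -> _) IH.
Qed.

Lemma sectionsM g h v : sections (g * h) v = sections g (h v) * sections h v.
Proof.
apply: tree_aut_eq => w; have := tree_autME g h (v ++ w).
rewrite !sections_cat => /eqP; rewrite eqseq_cat ?size_tree_aut //.
by move=> /andP[_ /eqP].
Qed.

Lemma sections1 v : sections 1 v = 1.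
Proof.
apply: tree_aut_eq => w; have /(congr1 (drop (size v))) := sections_cat 1 v w.
by rewrite !tree_aut1E !drop_size_cat.
Qed.

(* An automorphism trivial on level n is the product of its sections there. *)
Lemma level_sub K n g : is_subgroup K -> (forall v, size v = n -> g v = v) ->
  (forall v, size v = n -> K (deltas v (sections g v))) -> K g.
Proof.
elim: n K g => [|n IH] K g gK gid Kg; first exact: (Kg [::]).
have gx x : root_fun g x = x.
  have := gid (x :: nseq n x); rewrite tree_aut_cons /= size_nseq.
  by case/(_ erefl).
have -> : g = tuple_aut [ffun x => section g x].
  apply: tree_aut_eq => -[|x w]; first by rewrite !tree_aut_nil.
  by rewrite tree_aut_cons gx /= ffunE.
apply: tuple_aut_sub => // x; rewrite ffunE.
apply: (IH (delta x @^-1` K)) => [|v sv|v sv].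
- by apply: preimage_subgroup => //; exact: deltaM.
- by have := gid (x :: v); rewrite tree_aut_cons /= sv => /(_ erefl)[_].
- by apply: (Kg (x :: v)); rewrite /= sv.
Qed.

Lemma disjoint_commute g h v u : size u = size v -> u <> v ->
  (forall w, ~~ prefix u w -> g w = w) -> (forall w, ~~ prefix v w -> h w = w) ->
  g * h = h * g.
Proof.
move=> suv nuv gid hid.
(* If [f w] left the subtree below [z], it would be fixed by [f], and injectivity would give
   [f w = w]. *)
have stable f (z w : seq X) : (forall w, ~~ prefix z w -> f w = w) ->
    prefix z w -> prefix z (f w).
  move=> fid zw; apply: contraT => nz; have /(fid (f w)) := nz.
  have [fb _ _] := tree_autP f; move/(bij_inj fb) => fw.
  by rewrite fw zw in nz.
have disj w : prefix u w -> ~~ prefix v w.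
  move=> /prefixP[s ->]; apply/prefixP => -[s' /eqP]; rewrite eqseq_cat //.
  by case/andP=> /eqP.
apply: tree_aut_eq => w; rewrite !tree_autME.
have [uw|uw] := boolP (prefix u w).
  by rewrite (hid w) ?disj // hid // disj // stable.
rewrite (gid w) // gid //; have [vw|vw] := boolP (prefix v w).
  by apply: contraL (stable _ _ _ hid vw) => /disj.
by rewrite hid.
Qed.

Variable G : set (tree_aut X).
Hypothesis gG : is_subgroup G.
(** With the next hypothesis, the stabilizer of the first level in [G] is exactly the tuple group
    over [G]. *)
Hypothesis G_section : forall g x, G g -> G (section g x).
Hypothesis G_delta : forall g x, G g -> G (delta x g).

Lemma sub_sections g v : G g -> G (sections g v).
Proof. by elim: v g => //= x v IH g Gg; apply/IH/G_section. Qed.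

Lemma sub_deltas g v : G g -> G (deltas v g).
Proof. by elim: v => //= x v IH Gg; apply/G_delta/IH. Qed.

Lemma rist_deltas g v : G g -> rist_vertex G v (deltas v g).
Proof. by move=> Gg; split=> [|w]; [exact: sub_deltas|exact: deltas_id]. Qed.

Lemma sub_tuple F : (forall x, G (F x)) -> G (tuple_aut F).
Proof. by move=> GF; apply: tuple_aut_sub => // x; apply: G_delta. Qed.

(* h moves v, so that the conjugate of deltas v k by h commutes with every
   deltas v k'; thus [~ [~ h, deltas v k], deltas v k'] = deltas v [~ k, k']. *)
Lemma normal_derived N h v : is_normal N G -> N h -> h v <> v ->
  forall k, derived_subgroup G k -> N (deltas v k).
Proof.
move=> [gN NG NJ] Nh hv; have [N1 NM NV] := gN; have [G1 GM GV] := gG.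
apply: generated_min => [|_ [k Gk [k' Gk' <-]]].
  by apply: preimage_subgroup => //; exact: deltasM.
have deltasV g : deltas v g^-1 = (deltas v g)^-1.
  apply: (mulgI (deltas v g)); rewrite mulgV -deltasM mulgV.
  by apply: (mulgI (deltas v 1)); rewrite -deltasM !mulg1.
have Gdk := sub_deltas v Gk; have Gdk' := sub_deltas v Gk'.
have [t tE] : exists t, t = (deltas v k)^-1 ^ h by eexists.
have tC g : commute t (deltas v g).
  apply: (@disjoint_commute _ _ v (h^-1 v)) => [|hvv|w hw|w].
  - by rewrite size_tree_aut.
  - by apply: hv; rewrite -{1}hvv -tree_autME mulgV.
  - rewrite tE conjgE !tree_autME -deltasV deltas_id.
      by rewrite -tree_autME mulVg.
    apply: contra hw => /prefixP[s hws]; have := tree_autME h^-1 h w.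
    by rewrite mulVg hws sections_cat tree_aut1E => ->; exact: prefix_prefix.
  - exact: deltas_id.
have Nx : N (t * deltas v k).
  have -> : t * deltas v k = h^-1 * h ^ (deltas v k).
    by rewrite tE !conjgE -!mulgA.
  by apply: (NM _ _ (NV _ Nh)); exact: NJ.
have -> : deltas v [~ k, k'] = (t * deltas v k)^-1 * (t * deltas v k) ^ deltas v k'.
  rewrite commgEl (conjgE _ k') (conjgE _ (deltas v k')) !deltasM !deltasV.
  rewrite invMg -!mulgA.
  congr (_ * _); rewrite (mulgA t^-1) -invMg -(tC k') invMg.
  by rewrite -!mulgA !mulKg.
by apply: (NM _ _ (NV _ Nx)); exact: NJ.
Qed.

(** Modulo [K], an element is determined by its action on level [n] and the [chi] of its sections
    there: if these agree for [g] and [h], then [g^-1 * h] fixes the level and its sections lie in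
    the derived subgroup. *)
Lemma finite_index_level (T : finType) (chi : tree_aut X -> T) K n :
  (forall g h, G g -> G h -> chi g = chi h -> derived_subgroup G (g^-1 * h)) ->
  is_subgroup K ->
  (forall v, size v = n -> forall k, derived_subgroup G k -> K (deltas v k)) ->
  finite_index K G.
Proof.
move=> chiG gK Kd.
(* [g v] has length [n], so the default of [insubd] never occurs. *)
pose f g := [ffun v : n.-tuple X => (insubd v (g v), chi (sections g v))].
apply: (@finite_index_fun _ _ f) => // g h Gg Gh /ffunP fgh.
have gh v : size v = n -> g v = h v /\ chi (sections g v) = chi (sections h v).
  move=> /eqP sv; have := fgh (Tuple sv); rewrite !ffunE => -[/(congr1 val)].
  by rewrite !val_insubd !size_tree_aut sv.
apply: (@level_sub _ n) => // v sv.
  by rewrite tree_autME -(gh v sv).1 -tree_autME mulVg.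
apply: Kd => //; rewrite sectionsM -(gh v sv).1.
have -> : sections g^-1 (g v) = (sections g v)^-1.
  by apply: (mulIg (sections g v)); rewrite -sectionsM !mulVg sections1.
by apply: chiG; [exact: sub_sections|exact: sub_sections|exact: (gh v sv).2].
Qed.

Lemma just_infinite_sub (T : finType) (chi : tree_aut X -> T) :
  (forall g h, G g -> G h -> chi g = chi h -> derived_subgroup G (g^-1 * h)) ->
  level_transitive G -> just_infinite G.
Proof.
move=> chiG trG N nN nN1; have [gN NG NJ] := nN; have [N1 NM NV] := gN.
have [h [Nh /eqP h1]] : exists h, N h /\ h != 1.
  apply: contrapT => nh; apply: nN1; apply/seteqP; split=> [h Nh|_ -> //].
  by apply: contrapT => /eqP h1; apply: nh; exists h.
have [v hv] : exists v, h v <> v.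
  apply: contrapT => nv; apply: h1; apply: tree_aut_eq => v.
  by apply: contrapT => hv; apply: nv; exists v.
apply: (@finite_index_level _ chi _ (size v)) => // u su.
have [t Gt tv] := trG _ _ _ (erefl (size v)) su.
have [_ _ GV] := gG.
(* The conjugate [t * h * t^-1] sends [u = t v] to [t (h v)], hence moves [u]. *)
apply: (@normal_derived _ (h ^ t^-1)) => //; first by apply: NJ => //; exact: GV.
rewrite conjgE invgK !tree_autME -{1}tv -[_ (t v)]tree_autME mulVg -tv.
by have [tb _ _] := tree_autP t; move/(bij_inj tb).
Qed.

Lemma rist_finite_index (T : finType) (chi : tree_aut X -> T) n :
  (forall g h, G g -> G h -> chi g = chi h -> derived_subgroup G (g^-1 * h)) ->
  finite_index (rist_level G n) G.
Proof.
move=> chiG; apply: (@finite_index_level _ chi _ n) => //.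
  exact: generated_subgroup.
move=> v sv k /(derived_sub gG) Gk; apply: sub_generated; exists v => //.
exact: rist_deltas.
Qed.

Lemma rist_level1 : rist_level G 1 = power_subgroup G.
Proof.
have [G1 GM GV] := gG; apply/seteqP; split=> [|_ [F GF <-]]; last first.
  apply: tuple_aut_sub => [|x]; first exact: generated_subgroup.
  by apply: sub_generated; exists [:: x] => //; exact: (@rist_deltas _ [:: x]).
apply: generated_min => [|g [[|x [|]] //= _ [Gg gid]]].
  split=> [|_ _ [F GF <-] [F' GF' <-]|_ [F GF <-]].
  - exists [ffun=> 1] => [x|]; first by rewrite ffunE.
    by apply: tree_aut_eq => -[|x w] //=; rewrite ffunE.
  - exists [ffun x => F x * F' x]; last by rewrite tuple_autM.
    by move=> x; rewrite ffunE; exact: GM.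
  - exists [ffun x => (F x)^-1] => [x|]; first by rewrite ffunE; exact: GV.
    apply: (mulgI (tuple_aut F)); rewrite tuple_autM mulgV.
    by apply: tree_aut_eq => -[|x w] //=; rewrite !ffunE mulgV.
have gy y : y != x -> root_fun g y = y.
  move=> yx; have := gid [:: y]; rewrite tree_aut_cons /= eq_sym (negPf yx).
  by case/(_ isT).
(* The letter [x] is fixed too: otherwise its image is a fixed letter, contradicting injectivity. *)
have gx y : root_fun g y = y.
  have [->|/gy//] := eqVneq y x; apply: contrapT => /eqP gxx.
  by have /root_fun_inj := gy _ gxx; apply/eqP.
exists [ffun y => section g y] => [y|]; first by rewrite ffunE; exact: G_section.
apply: tree_aut_eq => -[|y w]; first by rewrite !tree_aut_nil.
by rewrite (tree_aut_cons g) gx /= ffunE.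
Qed.

End TreeAutomorphisms.

(** * Generating alternating groups, and isolating one entry of a tuple *)

Section Alternating.
Local Open Scope group_scope.

(** The factor [r] cancels in a quotient of two elements [tperm x y * r], which leaves a product of
    two transpositions; such products generate the alternating group. Transpositions not involving
    [x0] come from those that do, by conjugation. *)
Lemma Alt_sub (T : finType) (x0 : T) (r : {perm T}) (P : set {perm T}) :
  is_subgroup P -> (forall x, x != x0 -> P (tperm x0 x * r)) ->
  forall p, p \in 'Alt_T -> P p.
Proof.
move=> [P1 PM PV] Px0 p; rewrite Alt_even.
have Pr x y : x != y -> P (tperm x y * r).
  have [-> yx|x0x xy] := eqVneq x x0; first by apply: Px0; rewrite eq_sym.
  have [->|x0y] := eqVneq y x0; first by rewrite tpermC; exact: Px0.
  have -> : tperm x y * r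
      = (tperm x0 x * r) * (tperm x0 y * r)^-1 * (tperm x0 x * r).
    have -> : tperm x y = tperm x0 x * tperm x0 y * tperm x0 x.
      have := tpermJ x0 y (tperm x0 x); rewrite tpermL tpermD // 1?eq_sym //.
      by rewrite conjgE tpermV mulgA => <-.
    by rewrite invMg tpermV -!mulgA mulKVg.
  by apply: (PM); [apply: (PM); [|apply: PV]|]; exact: Px0.
have [ts -> dts] := prod_tpermP p; rewrite odd_perm_prod //.
(* Two transpositions are removed at a time; a single remaining one is excluded by parity. *)
have [n] := ubnP (size ts); elim: n ts dts => // n IH [|a [|b ts]] //.
  by rewrite big_nil.
move=> /= /and3P[da db dts] sts; rewrite negbK => ots; rewrite !big_cons mulgA.
apply: (PM); last by apply: IH => //; exact: ltnW.
have -> : tperm a.1 a.2 * tperm b.1 b.2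
    = (tperm a.1 a.2 * r) * (tperm b.1 b.2 * r)^-1.
  by rewrite invMg tpermV -!mulgA mulKVg.
by apply: (PM); [|apply: PV]; exact: Pr.
Qed.

(* The supports {p,q,r}, {u,q,v} and {u,v,r} of the three factors add up to {p}
   modulo 2. *)
Lemma delta_decomp (X : finType) (p q r u v : X) (g : tree_aut X) :
  uniq [:: p; q; r; u; v] -> g * g = 1 ->
  let F := [ffun x => if x \in [:: p; q; r] then g else 1] in
  delta p g = tuple_aut F
    * tuple_aut [ffun x => F ((tperm p u * tperm r v) x)]
    * tuple_aut [ffun x => F ((tperm p u * tperm q v) x)].
Proof.
move=> pqruv gg F; rewrite !tuple_autM; congr tuple_aut; apply/ffunP => x.
rewrite !ffunE !permM !permE /= !inE.
move: pqruv; rewrite /= !inE !negb_or => /and5P[/and4P[pq pr pu pv]].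
move=> /and3P[qr qu qv] /andP[ru rv] uv _.
pose ne := (negPf pq, negPf pr, negPf pu, negPf pv, negPf qr, negPf qu,
  negPf qv, negPf ru, negPf rv, negPf uv).
have [xE|xp] := eqVneq x p; [|have [xE|xq] := eqVneq x q;
  [|have [xE|xr] := eqVneq x r; [|have [xE|xu] := eqVneq x u;
  [|have [xE|xv] := eqVneq x v]]]]; rewrite ?xE;
  do 3?[rewrite ?eqxx ?[q == p]eq_sym ?[r == p]eq_sym ?[u == p]eq_sym
    ?[v == p]eq_sym ?[r == q]eq_sym ?[u == q]eq_sym ?[v == q]eq_sym
    ?[u == r]eq_sym ?[v == r]eq_sym ?[v == u]eq_sym ?ne /= ];
  rewrite ?mulg1 ?mul1g //.
by do 2?rewrite ?(negPf xp) ?(negPf xq) ?(negPf xr) /=; rewrite mulg1.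
Qed.

End Alternating.

(** * Words in the generators, with a computable wreath recursion *)

Definition state_code s :=
  match s with st1 => 0 | sta => 1 | stb => 2 | stc => 3 | std => 4 end.

Lemma state_code_inj : injective state_code.
Proof. by case; case. Qed.

HB.instance Definition _ := Equality.copy state (inj_type state_code_inj).

(** [state_perm] tabulated on natural numbers: tables evaluate, so finite claims about words are
    settled by computation. *)
Definition state_moves (s : state) : seq nat :=
  match s with
  | st1 => [:: 0; 1; 2; 3; 4; 5; 6; 7]
  | sta => [:: 1; 0; 2; 3; 4; 6; 5; 7]
  | stb => [:: 0; 1; 2; 5; 7; 3; 6; 4]
  | stc => [:: 0; 2; 1; 3; 4; 5; 7; 6]
  | std => [:: 3; 1; 4; 0; 2; 5; 6; 7]
  end.
Definition state_move s x := nth 0 (state_moves s) x.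

Section Words.
Local Open Scope group_scope.
Implicit Types (s t : state) (w : seq state) (x : 'I_8).

Lemma state_permE s x : state_perm s x = state_move s x :> nat.
Proof.
by case: s; case: x => -[|[|[|[|[|[|[|[|//]]]]]]]] lx;
  rewrite ?permM !permE /= -?val_eqE /= ?inordK //= -?val_eqE /= ?inordK.
Qed.

Lemma ord8_forall (P : pred nat) : all P (iota 0 8) -> forall x : 'I_8, P x.
Proof. by move=> /allP PP x; apply: PP; rewrite mem_iota /=. Qed.

Lemma state_moveK s x : state_move s (state_move s x) = x.
Proof.
apply/eqP; apply: (@ord8_forall (fun n => state_move s (state_move s n) == n)).
by case: s.
Qed.

Definition nat_section s (n : nat) : state := nth st1 (state_sections s) n.

Lemma nat_sectionE s x : nat_section s x = state_section s x.
Proof. by []. Qed.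

Lemma section_move s x : nat_section s (state_move s x) = nat_section s x.
Proof.
apply/eqP.
apply: (@ord8_forall (fun n => nat_section s (state_move s n) == nat_section s n)).
by case: s.
Qed.

Lemma section_cases s x :
  nat_section s x = st1 \/ nat_section s x = s /\ state_move s x = x.
Proof.
pose P n := (nat_section s n == st1)
  || (nat_section s n == s) && (state_move s n == n).
have /orP[/eqP|/andP[/eqP ? /eqP ?]] : P x; last by right.
  by apply: ord8_forall; rewrite /P; case: (s).
by left.
Qed.

Lemma state_aut_mulK s : state_aut s * state_aut s = 1.
Proof.
apply: tree_aut_eq => w; rewrite tree_autME tree_aut1E.
elim: w s => //= x w IH s; congr (_ :: _).
  by apply: val_inj; rewrite [LHS]state_permE state_permE state_moveK.
have -> : state_section s (state_perm s x) = state_section s x.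
  by rewrite -!nat_sectionE state_permE section_move.
exact: IH.
Qed.

Definition word_aut w : tree_aut 'I_8 := foldr (fun s g => state_aut s * g) 1 w.

Lemma word_aut_cat v w : word_aut (v ++ w) = word_aut v * word_aut w.
Proof. by elim: v => [|s v IH] /=; rewrite ?mul1g // IH mulgA. Qed.

Lemma word_aut_rev w : word_aut (rev w) = (word_aut w)^-1.
Proof.
elim: w => [|s w IH]; first by rewrite invg1.
rewrite rev_cons -cats1 word_aut_cat IH /= mulg1 invMg; congr (_ * _).
by apply: (mulgI (state_aut s)); rewrite state_aut_mulK mulgV.
Qed.

Definition word_move w (n : nat) : nat := foldr state_move n w.

(** Prepending with cancellation of [s s] and omission of the identity. Sections of words thus come
    out reduced, and many trivial ones are visibly empty. *)
Definition push s w : seq state :=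
  if s == st1 then w
  else if w is t :: w' then if t == s then w' else s :: w else [:: s].

Fixpoint word_section w (n : nat) : seq state :=
  if w is s :: w' then push (nat_section s (word_move w' n)) (word_section w' n)
  else [::].

Lemma word_aut_push s w : word_aut (push s w) = state_aut s * word_aut w.
Proof.
rewrite /push; have [->|_] := eqVneq s st1; first by rewrite state_aut1 mul1g.
by case: w => //= t w; case: eqP => // ->; rewrite mulgA state_aut_mulK mul1g.
Qed.

Lemma word_permE w x : root_perm (word_aut w) x = word_move w x :> nat.
Proof.
elim: w => [|s w IH]; first by rewrite permE.
have := congr1 (fun p => wr_perm p x) (wreath_recursionM (state_aut s) (word_aut w)).
rewrite wreath_recursion_state [LHS]/= [RHS]/= permM => ->.
by rewrite state_permE IH.
Qed.

Lemma word_sectionE w x : section (word_aut w) x = word_aut (word_section w x).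
Proof.
elim: w => [|s w IH]; first exact: tree_aut_eq.
have := congr1 (fun p => wr_sect p x) (wreath_recursionM (state_aut s) (word_aut w)).
rewrite wreath_recursion_state /= !ffunE => ->.
by rewrite IH word_aut_push -word_permE.
Qed.

(** The generators are involutions, so a reversed word represents the inverse and the words already
    give a subgroup. *)
Lemma carpetP g : carpet_group g <-> exists w, g = word_aut w.
Proof.
split=> [|[w ->]].
  move: g; apply: generated_min => [|g].
    split; first by exists [::].
      by move=> _ _ [v ->] [w ->]; exists (v ++ w); rewrite word_aut_cat.
    by move=> _ [w ->]; exists (rev w); rewrite word_aut_rev.
  have states s : exists w, state_aut s = word_aut w.
    by exists [:: s]; rewrite /= mulg1.
  by case=> [[[]|]|] ->.
have [G1 GM _] : is_subgroup carpet_group := generated_subgroup _.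
elim: w => // s w IH; apply: GM => //; case: s; first by rewrite state_aut1.
all: by apply: sub_generated; rewrite /=; tauto.
Qed.

End Words.

(** * The alternating group and the tuples inside the carpet group *)

Section Branching.
Local Open Scope group_scope.
Implicit Types (s t : state) (w : seq state) (x y : 'I_8) (p : {perm 'I_8}).

Definition rooted p : wreath 'I_8 := Wreath p [ffun=> 1].

Lemma rootedM p p' : rooted p * rooted p' = rooted (p' * p).
Proof. by apply: wreath_eq => //= x; rewrite !ffunE mulg1. Qed.

Definition carpet_wreath : set (wreath 'I_8) :=
  (@wreath_recursion 'I_8) @` carpet_group.

Lemma carpet_subgroup : is_subgroup carpet_group.
Proof. exact: generated_subgroup. Qed.

Lemma carpet_wreath_subgroup : is_subgroup carpet_wreath.
Proof.
have [G1 GM GV] := carpet_subgroup.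
have wr1 : wreath_recursion 1 = 1 :> wreath 'I_8.
  by apply: (mulgI (wreath_recursion 1)); rewrite -wreath_recursionM !mulg1.
split=> [|_ _ [g Gg <-] [h Gh <-]|_ [g Gg <-]]; first by exists 1.
  by exists (g * h); [exact: GM|rewrite wreath_recursionM].
exists g^-1; first exact: GV.
by apply: (mulgI (wreath_recursion g)); rewrite -wreath_recursionM !mulgV.
Qed.

Definition rooted_word w := all (fun n => nilp (word_section w n)) (iota 0 8).

Lemma rooted_wordP w :
  rooted_word w -> carpet_wreath (rooted (root_perm (word_aut w))).
Proof.
move=> /ord8_forall rw; exists (word_aut w); first by apply/carpetP; exists w.
apply: wreath_eq => // x; rewrite !ffunE word_sectionE.
by have := rw x; case: word_section.
Qed.

Definition swap (i j n : nat) := if n == i then j else if n == j then i else n.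

Lemma tperm_swap x y z : tperm x y z = swap x y z :> nat.
Proof. by rewrite permE /swap /= -!val_eqE; do !case: ifP. Qed.

(* If s and t are cyclically adjacent among a, b, c, d, then (st)^2 is a 3-cycle
   of letters whose only nontrivial section is (st)^2, at a fixed corner letter.
   Hence the commutator of two such elements attached to adjacent corners is
   rooted. *)
Definition corner_commutators : seq (seq state) :=
  let corners := [:: (sta, stb); (stb, stc); (stc, std); (std, sta)] in
  let squares := [seq [:: c.1; c.2; c.1; c.2] | c <- corners]
    ++ [seq [:: c.2; c.1; c.2; c.1] | c <- corners] in
  [seq w <- [::] :: [seq u ++ v ++ rev u ++ rev v | u <- squares, v <- squares]
     | rooted_word w].

(** These are the elements required by [Alt_sub] with [x0 = 0] and [r = (0 1)]: the identity for
    [k = 1], otherwise a 3-cycle on 0, 1, [k]. The empty word among the commutators allows one of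
    them to serve alone. *)
Lemma star_3cycles :
  all (fun k => has (fun w => all (fun n => word_move w n == swap 0 1 (swap 0 k n))
                                  (iota 0 8))
      [seq u ++ v | u <- corner_commutators, v <- corner_commutators])
    (iota 1 7).
Proof. by vm_compute. Qed.

Lemma carpet_rooted p : p \in 'Alt_('I_8) -> carpet_wreath (rooted p).
Proof.
have [W1 WM WV] := carpet_wreath_subgroup.
pose r : {perm 'I_8} := tperm (inord 0) (inord 1).
apply: (@Alt_sub _ (inord 0) r [set p | carpet_wreath (rooted p)]) => [|x x0] /=.
  split=> //= [q q' Wq Wq'|q Wq]; first by rewrite -rootedM; exact: WM.
  suff -> : rooted q^-1 = (rooted q)^-1 by exact: WV.
  by apply: (mulgI (rooted q)); rewrite rootedM mulVg mulgV.
have x1 : val x \in iota 1 7.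
  by rewrite mem_iota ltn_ord andbT lt0n; move: x0; rewrite -val_eqE /= inordK.
have /hasP[w /allpairsP[[u v] [uC vC ->]] /ord8_forall wE] :=
  allP star_3cycles _ x1.
move: uC vC wE; rewrite !mem_filter /= => /andP[ru _] /andP[rv _] wE.
suff -> : tperm (inord 0) x * r = root_perm (word_aut (u ++ v)).
  rewrite word_aut_cat; have [-> _] := wreath_recursionM (word_aut u) (word_aut v).
  by rewrite -rootedM; apply: WM; exact: rooted_wordP.
apply/permP => y; apply: val_inj; rewrite /= word_permE (eqP (wE y)) permM.
by rewrite !tperm_swap !inordK.
Qed.

(** Conjugation by the element of the group that applies [p] to the first letter and changes nothing
    else. *)
Lemma rooted_conj p (F : {ffun 'I_8 -> tree_aut 'I_8}) : p \in 'Alt_('I_8) ->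
  carpet_group (tuple_aut F) -> carpet_group (tuple_aut [ffun x => F (p x)]).
Proof.
move=> /carpet_rooted[t Gt tE] GF.
have [G1 GM GV] := carpet_subgroup.
suff -> : tuple_aut [ffun x => F (p x)] = t^-1 * (tuple_aut F * t).
  by apply: (GM); [exact: GV|exact: GM].
apply: (mulgI t); rewrite mulKVg; apply: wreath_recursion_inj.
rewrite !wreath_recursionM !wreath_recursion_tuple tE.
apply: wreath_eq => [|x] /=; first by rewrite mulg1 mul1g.
by rewrite !ffunE mul1g mulg1.
Qed.

Lemma Alt8_transitive x y : exists2 p, p \in 'Alt_('I_8) & p x = y.
Proof.
have tr : [transitive 'Alt_('I_8), on [set: 'I_8]%SET | 'P].
  by apply: ntransitive1 (Alt_trans 'I_8); rewrite card_ord.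
by have [p Ap ->] := atransP2 tr (finset.in_setT x) (finset.in_setT y); exists p.
Qed.

Lemma odd_tperm2 (p q r v : 'I_8) :
  uniq [:: p; q; r; v] -> tperm p q * tperm r v \in 'Alt_('I_8).
Proof.
rewrite Alt_even odd_permM !odd_tperm /= !inE !negb_or.
by move=> /and4P[/and3P[-> _ _] _ -> _].
Qed.

Lemma state_perm_even s : state_perm s \in 'Alt_('I_8).
Proof.
by case: s; rewrite ?group1 // odd_tperm2 //= !inE -!val_eqE /= !inordK.
Qed.

Lemma carpet_state s : carpet_group (state_aut s).
Proof. by apply/carpetP; exists [:: s]; rewrite /= mulg1. Qed.

(** In the product of [s] with the rooted element of the same action on letters, the actions cancel
    since [s] is an involution; the sections survive since they are constant on the orbits of
    [s]. *)
Lemma carpet_state_sections s :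
  carpet_group (tuple_aut [ffun x => state_aut (state_section s x)]).
Proof.
have [_ GM _] := carpet_subgroup.
have [t Gt tE] := carpet_rooted (state_perm_even s).
suff -> : tuple_aut [ffun x => state_aut (state_section s x)] = state_aut s * t.
  by apply: GM => //; exact: carpet_state.
apply: wreath_recursion_inj; rewrite wreath_recursionM wreath_recursion_tuple tE.
rewrite wreath_recursion_state; apply: wreath_eq => [|x] /=.
  apply/permP => x; apply: val_inj.
  by rewrite perm1 permM /= !state_permE state_moveK.
by rewrite !ffunE mulg1 -!nat_sectionE state_permE section_move.
Qed.

(** The last two factors in [delta_decomp] are conjugates of the first by double transpositions,
    which are even. *)
Lemma carpet_delta_from s (p q r u v : 'I_8) : uniq [:: p; q; r; u; v] ->
  (forall x, state_section s x = if x \in [:: p; q; r] then s else st1) ->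
  carpet_group (delta p (state_aut s)).
Proof.
move=> pqruv sE; have [_ GM _] := carpet_subgroup.
rewrite (delta_decomp pqruv (state_aut_mulK s)).
have := carpet_state_sections s.
have -> : [ffun x => state_aut (state_section s x)]
    = [ffun x => if x \in [:: p; q; r] then state_aut s else 1].
  by apply/ffunP => x; rewrite !ffunE sE; case: ifP => // _; rewrite state_aut1.
move=> GF; apply: (GM); first apply: (GM) => //.
all: apply: rooted_conj => //; apply: odd_tperm2; move: pqruv.
all: rewrite /= !inE !negb_or ?[u == r]eq_sym ?[u == q]eq_sym.
all: move=> /and5P[/and4P[pq pr pu pv] /and3P[qr qu qv] /andP[ru rv] uv _].
all: by rewrite !(pq, pr, pu, pv, qr, qu, qv, ru, rv, uv).
Qed.

Lemma carpet_delta_state s : exists x, carpet_group (delta x (state_aut s)).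
Proof.
have inord_uniq (l : seq nat) : all (gtn 8) l -> uniq l ->
    uniq [seq (inord k : 'I_8) | k <- l].
  move=> l8 ul; rewrite map_inj_in_uniq // => i j /(allP l8)/= i8 /(allP l8)/= j8.
  by move/(congr1 val); rewrite /= !inordK.
have mem_inord (l : seq nat) x : all (gtn 8) l ->
    (x \in [seq (inord k : 'I_8) | k <- l]) = (val x \in l).
  elim: l => //= k l IH /andP[k8 l8]; rewrite !inE IH // -val_eqE /= inordK //.
(* The first three letters are those where [s] has section [s]; the last two are any others. For
   [st1] every choice works. *)
pose c : seq nat := (match s with
  | st1 | sta => [:: 2; 4; 7; 0; 1]
  | stb => [:: 0; 1; 2; 3; 4]
  | stc => [:: 0; 3; 5; 1; 2]
  | std => [:: 5; 6; 7; 0; 1]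
  end)%N.
exists (inord (nth 0 c 0)).
apply: (@carpet_delta_from _ _ (inord (nth 0%N c 1)) (inord (nth 0 c 2))
  (inord (nth 0 c 3)) (inord (nth 0 c 4))).
  by apply: (inord_uniq [:: _; _; _; _; _]); rewrite /c; case: (s).
move=> x; rewrite (mem_inord [:: _; _; _]); last by rewrite /c; case: (s).
apply/eqP; apply: (@ord8_forall (fun n =>
  nat_section s n
  == if n \in [:: nth 0 c 0; nth 0%N c 1; nth 0 c 2] then s else st1)).
by rewrite /c; case: (s).
Qed.

(** [delta x] is a homomorphism, so generators suffice; transitivity of the alternating group
    carries the one letter found for each generator to [x]. *)
Lemma carpet_delta g x : carpet_group g -> carpet_group (delta x g).
Proof.
have gG := carpet_subgroup.
move: g; apply: (@generated_min _ (delta x @^-1` carpet_group)) => [|g Sg].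
  by apply: preimage_subgroup => //; exact: deltaM.
have [s ->] : exists s, g = state_aut s.
  by case: Sg => [[[]|]|] ->; eexists.
have [y Gy] := carpet_delta_state s; have [p Ap pxy] := Alt8_transitive x y.
have := rooted_conj Ap Gy; rewrite /=; congr (carpet_group (tuple_aut _)).
by apply/ffunP => z; rewrite !ffunE -pxy (inj_eq perm_inj).
Qed.

Lemma carpet_section g x : carpet_group g -> carpet_group (section g x).
Proof.
move=> /carpetP[w ->]; rewrite word_sectionE.
by apply/carpetP; eexists.
Qed.

Lemma carpet_even g : carpet_group g -> root_perm g \in 'Alt_('I_8).
Proof.
move=> /carpetP[w ->]; elim: w => [|s w IH].
  by rewrite (_ : root_perm _ = 1) ?group1 //; apply/permP=> x; rewrite permE perm1.
have [-> _] := wreath_recursionM (state_aut s) (word_aut w).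
rewrite groupM //; have [-> _] := wreath_recursion_state s.
exact: state_perm_even.
Qed.

Lemma carpet_wreathE : carpet_wreath = alt_wreath carpet_group.
Proof.
have [W1 WM WV] := carpet_wreath_subgroup.
apply/seteqP; split=> [_ [g Gg <-]|[p F] [/= Ap GF]].
  split; first exact: carpet_even.
  by move=> x; rewrite /= ffunE; exact: carpet_section.
have -> : Wreath p F = rooted p * Wreath 1 F.
  by apply: wreath_eq => [|x] /=; rewrite ?mul1g // !ffunE mul1g.
apply: WM; first exact: carpet_rooted.
exists (tuple_aut F); last exact: wreath_recursion_tuple.
by apply: sub_tuple => //; [exact: carpet_subgroup|exact: carpet_delta].
Qed.

Lemma carpet_transitive : level_transitive carpet_group.
Proof.
elim=> [|n IH] [|x u] [|y v] //= => [_ _|[su] [sv]].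
  by have [G1 _ _] : is_subgroup carpet_group := generated_subgroup _; exists 1.
have [h Gh huv] := IH u v su sv; have [p Ap pxy] := Alt8_transitive x y.
(* Send the first letter by [p] and use the same section [h] everywhere; [carpet_wreathE] realizes
   this in the group. *)
have : alt_wreath carpet_group (Wreath p [ffun=> h]).
  by split=> //= z; rewrite ffunE.
rewrite -carpet_wreathE => -[g Gg [gp /ffunP gs]]; exists g => //.
rewrite tree_aut_cons -[section_fun g x u]/(section g x u).
have := gs x; rewrite !ffunE => ->; rewrite huv -pxy -gp permE //.
Qed.

End Branching.

(** * The abelianization, through parities of generators in words *)

Section Abelianization.
Local Open Scope group_scope.
Implicit Types (s t : state) (w : seq state) (x y : 'I_8).

Lemma odd_count_push s t w : s != st1 ->
  odd (count_mem s (push t w)) = (t == s) (+) odd (count_mem s w).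
Proof.
rewrite /push eq_sym => s1; have [->|_] := eqVneq t st1; first by rewrite (negPf s1).
case: w => [|t' w] /=; first by case: eqP.
by have [->|_] := eqVneq t' t => /=; rewrite !oddD !oddb ?addbA ?addbb.
Qed.

(** A letter [s] contributes [s] to three of the eight sections, an odd number, and cancellation in
    [push] preserves parity. *)
Lemma odd_count_sections s w : s != st1 ->
  \big[addb/false]_(x < 8) odd (count_mem s (word_section w x))
  = odd (count_mem s w).
Proof.
elim: w => [|t w IH] s1 /=; first by rewrite big1.
under eq_bigr => x _ do rewrite odd_count_push // -word_permE.
rewrite big_split /= IH // oddD oddb; congr (_ (+) _).
(* The rest of the word only permutes the letters at which [t] is evaluated. *)
rewrite -(reindex_inj (P := xpredT)
  (F := fun x : 'I_8 => nat_section t x == s) perm_inj).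
by case: t {IH}; case: s s1 => // _; rewrite !big_ord_recl big_ord0.
Qed.

Lemma size_push s w : size (push s w) <= (size w).+1 ?= iff
  (s != st1) && (ohead w != Some s).
Proof.
rewrite /push; have [_|_] /= := eqVneq s st1.
  by split=> //; rewrite ltn_eqF.
case: w => [|t w] /=; first by split.
rewrite (inj_eq Some_inj); have [_|_] := eqVneq t s; split=> //=;
  last by rewrite eqxx.
  by rewrite ltnW // ltnW.
by rewrite ltn_eqF // ltnW.
Qed.

Lemma size_word_section w n : size (word_section w n) <= size w.
Proof.
by elim: w => //= s w IH; apply: leq_trans (size_push _ _) _.
Qed.

(** Full length means that no letter was dropped or cancelled. By [section_cases], each letter then
    contributes itself and fixes [x]. *)
Lemma word_section_full w x : size (word_section w x) = size w ->
  word_move w x = x /\ all (fun s => nat_section s x == s) w.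
Proof.
elim: w => //= s w IH; set t := nat_section _ _ => st.
have sw := size_word_section w x.
have ws : size (word_section w x) = size w.
  by apply/eqP; rewrite eqn_leq sw -ltnS -st (size_push t _).
have [wx aw] := IH ws; move/eqP: st.
rewrite -ws (size_push t _) /t wx.
by have [->|[-> ->]] := section_cases s x; rewrite ?eqxx.
Qed.

(* The states t with section t at x are 1 and the generators attached to the
   side or to the corner x. *)
Lemma corner_mover s x : s != st1 -> nat_section s x = s ->
  exists2 y : 'I_8, state_move s y != y &
  forall t, nat_section t x = t -> t != s ->
    state_move t y = y /\ state_move t (state_move s y) = state_move s y.
Proof.
pose states := [:: st1; sta; stb; stc; std].
have statesP u : u \in states by case: u.
pose P n := all (fun s => (s != st1) ==> (nat_section s n == s) ==>
    has (fun k => (state_move s k != k) &&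
      all (fun t => (nat_section t n == t) ==> (t != s) ==>
        (state_move t k == k) && (state_move t (state_move s k) == state_move s k))
      states)
    (iota 0 8)) states.
move=> s1 sx; have : P x by apply: ord8_forall; vm_compute.
move=> /allP/(_ s (statesP s)); rewrite s1 sx eqxx => /hasP[k].
rewrite mem_iota => k8 /andP[sk /allP tk]; exists (Ordinal k8) => //= t tx ts.
by have := tk t (statesP t); rewrite tx eqxx ts => /andP[/eqP-> /eqP->].
Qed.

Lemma trivial_word_even s w :
  s != st1 -> word_aut w = 1 -> ~~ odd (count_mem s w).
Proof.
move=> s1; have [n] := ubnP (size w); elim: n w => // n IH w /ltnSE swn w1.
have [/existsP[x /eqP/word_section_full[_ /allP wx]]|/existsPn short] :=
  boolP [exists x : 'I_8, size (word_section w x) == size w].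
  apply/negP => odd_s; have sw : s \in w by rewrite -has_pred1 has_count odd_gt0.
  have [y sy ty] := corner_mover s1 (eqP (wx s sw)).
  (* The other letters of [w] fix both [y] and its image under [s], so only the parity of [s]
     matters; an odd count would move [y]. *)
  have wy : word_move w y = if odd (count_mem s w) then state_move s y else y.
    elim: w wx {swn w1 odd_s sw} => //= t w IHw tw; rewrite IHw; last first.
      by move=> u uw; apply: tw; rewrite inE uw orbT.
    have /eqP tx := tw t (mem_head _ _); rewrite oddD oddb.
    have [-> | ts] := eqVneq t s; first by case: (odd _) => //=; rewrite state_moveK.
    by have [ty1 ty2] := ty t tx ts; case: (odd _).
  have := word_permE w y; rewrite w1 permE wy odd_s => yE.
  by rewrite -yE eqxx in sy.
(* All sections are shorter words for the identity, so induction makes every summand even. *)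
rewrite -odd_count_sections // big1 // => x _; apply: negbTE; apply: IH.
  by apply: leq_trans swn; rewrite ltn_neqAle short size_word_section.
by rewrite -word_sectionE w1; exact: tree_aut_eq.
Qed.

(** The first letter [s] recurs, and [s v s z = [s, v^-1] v z] removes both occurrences at the cost
    of a commutator. *)
Lemma even_word_derived w : (forall s, s != st1 -> ~~ odd (count_mem s w)) ->
  derived_subgroup carpet_group (word_aut w).
Proof.
have gD := generated_subgroup [set [~ x, y] | x in carpet_group & y in carpet_group].
have [D1 DM _] := gD.
have [n] := ubnP (size w); elim: n w => // n IH [//|s w] /ltnSE swn even.
have [s1|s1] := eqVneq s st1.
  rewrite /= s1 state_aut1 mul1g; apply: IH => // t t1; have := even t t1.
  by rewrite /= s1 eq_sym (negPf t1).
have sw : s \in w.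
  have := even s s1; rewrite /= eqxx oddD /= negbK => odd_s.
  by rewrite -has_pred1 has_count odd_gt0.
case/splitPr: sw swn even => v z swn even.
have -> : word_aut (s :: v ++ s :: z)
    = [~ state_aut s, (word_aut v)^-1] * word_aut (v ++ z).
  rewrite /= !word_aut_cat /= commgEl conjgE invgK !mulgA mulgKV.
  congr (_ * _ * _ * _).
  by apply: (mulgI (state_aut s)); rewrite state_aut_mulK mulgV.
apply: DM.
  apply: sub_generated; exists (state_aut s); first exact: carpet_state.
  exists (word_aut v)^-1 => //; apply/carpetP; exists (rev v).
  by rewrite word_aut_rev.
apply: IH => [|t t1].
  apply: leq_trans swn; by rewrite /= !size_cat /= addnS ltnS ?leqnSn.
have := even t t1; rewrite /= !count_cat /= !oddD.
by case: (s == t); case: (odd (count _ v)); case: (odd (count _ z)).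
Qed.

Definition generator (i : 'I_4) : state := nth st1 [:: sta; stb; stc; std] i.

Definition word_parity w : 'rV['Z_2]_4 :=
  (\row_i (count_mem (generator i) w)%:R)%R.

Lemma word_parity_cat v w : word_parity (v ++ w) = (word_parity v + word_parity w)%R.
Proof. by apply/rowP => i; rewrite !mxE count_cat GRing.natrD. Qed.

Lemma word_parity_rev w : word_parity (rev w) = (- word_parity w)%R.
Proof.
apply/rowP => i; rewrite !mxE count_rev.
(* Negation is the identity on ['Z_2]. *)
by case: (_ %:R)%R => -[|[|//]] lt2; apply: val_inj.
Qed.

Lemma word_parity0 w :
  word_parity w = 0%R <-> forall s, s != st1 -> ~~ odd (count_mem s w).
Proof.
have parE i : (word_parity w 0 i == 0)%R = ~~ odd (count_mem (generator i) w).
  by rewrite mxE -val_eqE /= val_Zp_nat // modn2 eqb0.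
split=> [w0 s s1|even].
  have [i ->] : exists i, s = generator i.
    by case: s s1 => // _; [exists (inord 0)|exists (inord 1)|exists (inord 2)
      |exists (inord 3)]; rewrite /generator inordK.
  by rewrite -parE w0 mxE.
apply/rowP => i; rewrite [RHS]mxE; apply/eqP; rewrite parE; apply: even.
by case: i => -[|[|[|[|]]]].
Qed.

HB.instance Definition _ := gen_choiceMixin state.

(** Read off from a chosen word; [carpet_parity_word] shows independence of the choice. Outside the
    group the empty word gives 0. *)
Definition carpet_parity (g : tree_aut 'I_8) : 'rV['Z_2]_4 :=
  word_parity (xget [::] [set w | g = word_aut w]).

Lemma carpet_parity_word w : carpet_parity (word_aut w) = word_parity w.
Proof.
rewrite /carpet_parity.
have /= := @xgetPex _ [::] [set v | word_aut w = word_aut v] (ex_intro _ w erefl).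
set v := xget _ _ => wv; apply/eqP; rewrite -GRing.subr_eq0; apply/eqP.
(* Two words for the same element: one followed by the reverse of the other represents 1, so all its
   counts are even. *)
rewrite -word_parity_rev -word_parity_cat; apply/word_parity0 => s s1.
by apply: trivial_word_even; rewrite // word_aut_cat word_aut_rev -wv mulgV.
Qed.

Lemma carpet_parityM g h : carpet_group g -> carpet_group h ->
  carpet_parity (g * h) = (carpet_parity g + carpet_parity h)%R.
Proof.
move=> /carpetP[v ->] /carpetP[w ->].
by rewrite -word_aut_cat !carpet_parity_word word_parity_cat.
Qed.

Lemma carpet_parity_derived g h : carpet_group g -> carpet_group h ->
  carpet_parity g = carpet_parity h -> derived_subgroup carpet_group (g^-1 * h).
Proof.
move=> /carpetP[v ->] /carpetP[w ->]; rewrite !carpet_parity_word => vw.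
rewrite -word_aut_rev -word_aut_cat; apply: even_word_derived; apply/word_parity0.
by rewrite word_parity_cat word_parity_rev vw GRing.addNr.
Qed.

Lemma carpet_parity0 g : carpet_group g ->
  carpet_parity g = 0%R <-> derived_subgroup carpet_group g.
Proof.
move=> Gg; split=> [g0|]; last first.
  exact: (zmod_hom_derived carpet_subgroup carpet_parityM).
have par1 := zmod_hom1 carpet_subgroup carpet_parityM.
have [G1 _ _] := carpet_subgroup.
by rewrite -[g]mul1g -invg1; apply: carpet_parity_derived; rewrite ?par1 ?g0.
Qed.

Lemma carpet_parity_onto v : exists2 g, carpet_group g & carpet_parity g = v.
Proof.
pose w := flatten [seq nseq (v ord0 i) (generator i) | i <- enum 'I_4].
exists (word_aut w); first by apply/carpetP; exists w.
rewrite carpet_parity_word; apply/rowP => i; rewrite mxE -[RHS]natr_Zp.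
congr (_%:R)%R; rewrite count_flatten -map_comp sumnE big_map big_enum /=.
rewrite (bigD1 i) //= big1 => [|j ji].
  by rewrite addn0 count_nseq /= eqxx mul1n.
rewrite count_nseq /=; case: eqP => // gij; case/eqP: ji; apply: ord_inj.
move: gij; rewrite /generator; case: i => -[|[|[|[|//]]]] ?;
  by case: j => -[|[|[|[|//]]]].
Qed.

End Abelianization.

Theorem proposition6p4 :
  [/\ branch carpet_group,
      just_infinite carpet_group,
      rist_level carpet_group 1 = power_subgroup carpet_group,
      isomorphism (fun g h => (g * h)%g) (fun p q => (p * q)%g)
        carpet_group (alt_wreath carpet_group) (@wreath_recursion 'I_8)
    & isomorphic (@set_mul (tree_aut 'I_8)) (fun u v => (u + v)%R)
        (cosets carpet_group (derived_subgroup carpet_group))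
        [set: 'rV['Z_2]_4] ].
Proof.
have gG := carpet_subgroup.
have Gsec := carpet_section; have Gdel := carpet_delta.
have chiG := carpet_parity_derived.
split.
- split=> [|n]; first exact: carpet_transitive.
  by apply: (rist_finite_index gG _ _ n chiG).
- by apply: (just_infinite_sub gG _ _ chiG) => //; exact: carpet_transitive.
- by apply: rist_level1.
- split; last by move=> g h _ _; exact: wreath_recursionM.
  rewrite -carpet_wreathE; split=> [g Gg|g h _ _|//]; first by exists g.
  exact: wreath_recursion_inj.
apply: (cosets_isomorphic gG carpet_parityM).
- exact: generated_subgroup.
- exact: carpet_parity0.
- exact: derived_sub.
- exact: carpet_parity_onto.
Qed.
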